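(* Assume the asymptotic setting below together with conditions (A1)–(A3). Then $$\Big|\frac{\hat b_S}{\mathrm{tr}(W)}-\frac{b^*}{\mathrm{tr}(W)}\Big|\to0\quad\text{almost surely as }n\to\infty.$$
   Context: Asymptotic setting. For each $n$, let $p=p_n$ and let $\Psi=\Psi_n$ be a $p\times p$ positive definite matrix. Let $Y$ be a $p\times(n-1)$ random matrix with i.i.d. columns distributed as $\mathcal N_p(0,\Psi)$, and $W=YY^\top$. (This arises from the Bayesian model $x_i\mid\theta_i\sim\mathcal N_p(\theta_i,I_p)$, $\theta_i\mid\mu\sim\mathcal N_p(\mu,\Lambda)$, $\mu$ flat on $\mathbb R^p$, with $\Psi=I_p+\Lambda$ and $W=(X-\bar X)(X-\bar X)^\top$.) Let $\hat\alpha\ge0$ be a scalar statistic (function of $W$), $c_0\ge0$ a fixed constant, $V=(W+\hat\alpha I_p)^{-1}$, and define $$\hat a_S=\frac{(n-p-1)\mathrm{tr}(V)+\hat\alpha(\mathrm{tr}V)^2}{\mathrm{tr}(V^2W)}-(2c_0+1),\quad \hat b_S=\{(n-1)p-2\}-\mathrm{tr}(VW)\hat a_S,\quad b^*=-\hat a_S\,\mathrm{tr}(VW)+\mathrm{tr}(W\Psi^{-1}).$$ ($b^*$ minimizes over $b$ the loss $\frac1{np}\mathrm{tr}\{(\hat a_SV+b(\mathrm{tr}W)^{-1}I_p-\Psi^{-1})^2W\}$.) Conditions: (A1) $n/p\to\gamma$ as $n\to\infty$, where $0<\gamma<\infty$ and $\gamma\ne1$. (A2) There are constants $0<c_1\le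 c_2$ such that all eigenvalues $\tau_1,\dots,\tau_p$ of $\Psi$ lie in $[c_1,c_2]$ for all $n$, and the empirical spectral distribution $H_p(\tau)=p^{-1}\sum_{j=1}^p1_{[\tau_j,\infty)}(\tau)$ converges to a nonrandom probability distribution $H$. (A3) $\hat\alpha/n\to\alpha$ almost surely as $n\to\infty$, for some constant $\alpha>0$. *)

(* Defs.v *)
From HB Require Import structures.
From mathcomp Require Import all_boot all_order all_algebra.
From mathcomp Require Import all_classical all_reals all_analysis.
Set Implicit Arguments. Unset Strict Implicit. Unset Printing Implicit Defensive.
Import Order.TTheory GRing.Theory Num.Theory.
Import numFieldNormedType.Exports.
Local Open Scope classical_set_scope.
Local Open Scope ring_scope.

Section defs.
Context {R : realType} {d : measure_display} {T : measurableType d}.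

Definition posdef (p : nat) (Psi : 'M[R]_p) : Prop :=
  Psi^T = Psi /\ forall x : 'cV[R]_p, x != 0 -> 0 < (x^T *m Psi *m x) 0 0.

(* X : T -> 'cV_p is a N_p(0, Psi) random vector (Cramer--Wold definition):
   its coordinates are random variables and every nonzero linear combination
   a^T X has law N(0, a^T Psi a). (normal_prob m s has mean m and std dev s.) *)
Definition gaussian_vec (P : probability T R) (p : nat) (X : T -> 'cV[R]_p)
    (Psi : 'M[R]_p) : Prop :=
  (forall i, measurable_fun setT (fun w => X w i 0)) /\
  forall a : 'cV[R]_p, a != 0 ->
    forall B : set R, measurable B ->
      P [set w | (a^T *m X w) 0 0 \in B] =
      normal_prob 0 (Num.sqrt ((a^T *m Psi *m a) 0 0)) B.

Definition indep_columns (P : probability T R) (p m : nat)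
    (Y : T -> 'M[R]_(p, m)) : Prop :=
  forall t : 'I_m -> 'cV[R]_p,
    P [set w | forall j i, Y w i j <= t j i 0] =
    \big[*%E/1%E]_(j < m) P [set w | forall i, Y w i j <= t j i 0].

Definition iid_gaussian_columns (P : probability T R) (p m : nat)
    (Y : T -> 'M[R]_(p, m)) (Psi : 'M[R]_p) : Prop :=
  (forall j, gaussian_vec P (fun w => col j (Y w)) Psi) /\ indep_columns P Y.

End defs.

Section spectral.
Context {R : realType}.

Definition eigenvalues_of (p : nat) (Psi : 'M[R]_p) (tau : 'I_p -> R) : Prop :=
  char_poly Psi = \prod_(j < p) ('X - (tau j)%:P).

Definition esd (p : nat) (tau : 'I_p -> R) (x : R) : R :=
  (#|[set j : 'I_p | tau j <= x]|)%:R / p%:R.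

Definition distribution_function (H : R -> R) : Prop :=
  {homo H : x y / x <= y} /\ (forall x : R, H y @[y --> x^'+] --> H x) /\
  H y @[y --> -oo] --> (0 : R) /\ H y @[y --> +oo] --> (1 : R).

Definition cvg_distribution (F : nat -> R -> R) (H : R -> R) : Prop :=
  forall x, {for x, continuous H} -> (fun n => F n x) @ \oo --> H x.

End spectral.

Section estimators.
Context {R : realType}.
Variables (n p : nat) (W : 'M[R]_p) (alphahat c0 : R).

Definition Vmat : 'M[R]_p := invmx (W + alphahat%:M).

Definition a_S : R :=
  ((n%:R - p%:R - 1) * \tr Vmat + alphahat * (\tr Vmat) ^+ 2)
    / \tr (Vmat *m Vmat *m W) - (2 * c0 + 1).

Definition b_S : R :=
  ((n%:R - 1) * p%:R - 2) - \tr (Vmat *m W) * a_S.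

Definition b_star (Psi : 'M[R]_p) : R :=
  - a_S * \tr (Vmat *m W) + \tr (W *m invmx Psi).

End estimators.

(* Main.v *)
Require Import Defs.
From HB Require Import structures.
From mathcomp Require Import all_boot all_order all_algebra.
From mathcomp Require Import all_classical all_reals all_analysis.
From mathcomp Require Import measurable_realfun.
From mathcomp Require Import ring lra.
Import Order.TTheory GRing.Theory Num.Theory.
Import numFieldNormedType.Exports.
Local Open Scope classical_set_scope.
Local Open Scope ring_scope.

Set Implicit Arguments.
Unset Strict Implicit.
Unset Printing Implicit Defensive.

(* The terms involving a_S cancel, so the difference is
   (N - 2 - S) / tr W with N = (n - 1) p and S = tr (W Psi^-1).  Whitening the
   columns of Y exhibits S as a sum of N squared standard Gaussians: S has mean
   N, and variance 2 N (only pairwise independence of the columns and fourth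
   moments within a column are needed).  Since N grows like n^2, the series of
   the E (S / N - 1)^2 = 2 / N converges, so S / N -> 1 almost surely; finally
   tr W >= c1 S because Psi >= c1. *)

(** The hypotheses give less than the argument consumes. The numbers [tau n j] are only roots of the
    characteristic polynomial, so the lower bound on [Psi n] comes from a supremum argument rather
    than from diagonalization, and the whitening matrix from elimination rather than from a square
    root. A Gaussian vector is known only through the laws of its single linear forms, so the mixed
    moment of two whitened coordinates needs a polarization identity. Independence is only a product
    formula for orthants involving all columns at once: pairs are extracted by a limit, and a
    pi-system argument then reaches general events of two columns. Nothing relates [Y n] for
    distinct [n], so almost sure convergence has to come from summable second moments. Expectations
    are integrals of nonnegative functions with extended real values: identities are arranged
    without subtraction, and finiteness is read off at the end. *)

Section posdef_theory.
Context {R : realType}.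

(** * Positive definite matrices: whitening and spectral lower bound *)

Lemma posdef_congr (p : nat) (M U : 'M[R]_p) : U \in unitmx -> posdef M -> posdef (U^T *m M *m U).
Proof.
move=> Uu [Ms Mp]; split; first by rewrite !trmx_mul trmxK Ms mulmxA.
move=> x x0; have -> : x^T *m (U^T *m M *m U) *m x = (U *m x)^T *m M *m (U *m x).
  by rewrite trmx_mul !mulmxA.
apply: Mp; apply: contra_neq x0 => Ux0.
by rewrite -[x](mulKmx Uu) Ux0 mulmx0.
Qed.

(** Gaussian elimination, by induction on the size: [U] clears the off-diagonal blocks, the Schur
    complement [s] inherits positivity and is treated recursively, and [D] rescales the pivot. The
    congruence form serves twice: [A^T] whitens a vector of covariance [M], and [A *m A^T] is the
    inverse of [M]. *)
Lemma posdef_factor (p : nat) (M : 'M[R]_p) : posdef M ->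
  exists2 A : 'M[R]_p, A \in unitmx & A^T *m M *m A = 1%:M.
Proof.
elim: p M => [|p IH] M Mpd.
  by exists 1%:M; [exact: unitmx1 | apply/matrixP => -[]].
change 'M[R]_(1 + p) in M.
pose a := ulsubmx M; pose b := ursubmx M; pose c := drsubmx M.
have [Ms Mp] := Mpd.
have ME : M = block_mx a b b^T c.
  rewrite -[LHS](@submxK _ 1 p 1 p) /a /b /c; congr block_mx.
  by rewrite trmx_ursub Ms.
have a_gt0 : 0 < a 0 0.
  have : (delta_mx 0 0 : 'cV[R]_(1 + p)) != 0.
    apply/eqP => /matrixP/(_ 0 0); rewrite !mxE !eqxx => /eqP; by rewrite oner_eq0.
  move=> /Mp; rewrite trmx_delta -rowE -colE !mxE.
  by congr (0 < M _ _); apply/val_inj.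
pose al := a 0 0.
have aE : a = al%:M by rewrite [a]mx11_scalar.
pose U : 'M[R]_(1 + p) := block_mx 1%:M (- al^-1 *: b) 0 1%:M.
have Uu : U \in unitmx by rewrite unitmxE det_ublock !det1 mulr1 unitr1.
have cs : c^T = c by rewrite /c trmx_drsub Ms.
pose s := c - al^-1 *: (b^T *m b).
have UMU : U^T *m M *m U = block_mx al%:M 0 0 s.
  rewrite ME /U tr_block_mx !mulmx_block aE !trmx1 !trmx0 !mul1mx !mul0mx !addr0 !mulmx1 !mulmx0 !addr0.
  have alb : al * - al^-1 = -1 by rewrite mulrN divff ?gt_eqF.
  have -> : al%:M *m (- al^-1 *: b) + b = 0.
    by rewrite mul_scalar_mx scalerA alb scaleN1r addNr.
  have -> : (- al^-1 *: b)^T *m al%:M + b^T = 0.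
    by rewrite mul_mx_scalar linearZ /= scalerA alb scaleN1r addNr.
  congr block_mx.
  by rewrite mul0mx add0r /s linearZ /= -scalemxAl scaleNr addrC.
have Dpd := posdef_congr Uu Mpd; rewrite UMU in Dpd.
have spd : posdef s.
  split; first by rewrite /s linearB linearZ /= trmx_mul trmxK cs.
  move=> x x0; have := Dpd.2 (col_mx 0 x).
  rewrite tr_col_mx trmx0 mul_row_block mul_row_col !mul0mx !mulmx0 !add0r; apply.
  apply: contra_neq x0 => x0; apply/colP => i; rewrite mxE.
  by have /colP/(_ (rshift 1 i)) := x0; rewrite col_mxEd mxE.
have [B Bu BsB] := IH s spd.
pose D : 'M[R]_(1 + p) := block_mx (Num.sqrt al)^-1%:M 0 0 B.
have sal : 0 < Num.sqrt al by rewrite sqrtr_gt0.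
have Du : D \in unitmx.
  rewrite unitmxE det_ublock det_scalar1 unitrM -unitmxE Bu andbT.
  by rewrite unitfE invr_eq0 gt_eqF.
exists (U *m D); first by rewrite unitmx_mul Uu.
have -> : (U *m D)^T *m M *m (U *m D) = D^T *m (U^T *m M *m U) *m D.
  by rewrite trmx_mul !mulmxA.
rewrite UMU.
rewrite /D tr_block_mx !mulmx_block !trmx0 !mul0mx !mulmx0 !addr0 !add0r ?mulmx0 ?mul0mx.
rewrite BsB tr_scalar_mx -!scalar_mxM.
have -> : (Num.sqrt al)^-1 * al * (Num.sqrt al)^-1 = 1.
  rewrite -[X in _ * X / _](sqr_sqrtr (ltW a_gt0)) -/al.
  by rewrite expr2 mulrA mulVf ?gt_eqF// mul1r divff ?gt_eqF.
by rewrite -scalar_mx_block.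
Qed.

Lemma posdef_unitmx (p : nat) (M : 'M[R]_p) : posdef M -> M \in unitmx.
Proof.
move=> /posdef_factor[A _ AM].
have : A^T *m M *m A \in unitmx by rewrite AM unitmx1.
by rewrite !unitmx_mul => /andP[/andP[]].
Qed.

Lemma sqnorm_ge0 (p : nat) (x : 'cV[R]_p) : 0 <= (x^T *m x) 0 0.
Proof. by rewrite mxE sumr_ge0// => i _; rewrite mxE -expr2 sqr_ge0. Qed.

Lemma sqnorm_eq0 (p : nat) (x : 'cV[R]_p) : ((x^T *m x) 0 0 == 0) = (x == 0).
Proof.
apply/idP/eqP => [|->]; last by rewrite mulmx0 mxE.
rewrite mxE psumr_eq0; last by move=> i _; rewrite mxE -expr2 sqr_ge0.
move=> /allP H; apply/colP => i; rewrite mxE; apply/eqP.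
by have := H i (mem_index_enum _); rewrite mxE mulf_eq0 orbb.
Qed.

(** Cauchy--Schwarz: the squared norm of [a *: y - b *: x] equals [a * (a * c - b ^+ 2)]. *)
Lemma sqdot_le (p : nat) (x y : 'cV[R]_p) :
  ((x^T *m y) 0 0) ^+ 2 <= (x^T *m x) 0 0 * (y^T *m y) 0 0.
Proof.
have [->|x0] := eqVneq x 0; first by rewrite trmx0 !mul0mx mxE expr0n mul0r.
have yx : (y^T *m x) 0 0 = (x^T *m y) 0 0.
  by rewrite !mxE; apply: eq_bigr => i _; rewrite !mxE mulrC.
set a := (x^T *m x) 0 0; set b := (x^T *m y) 0 0; set c := (y^T *m y) 0 0.
have a0 : 0 < a by rewrite lt_neqAle sqnorm_ge0 eq_sym sqnorm_eq0 x0.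
have := sqnorm_ge0 (a *: y - b *: x).
have -> : (a *: y - b *: x)^T = a *: y^T - b *: x^T.
  by apply/matrixP => i j; rewrite !mxE.
rewrite mulmxBl !mulmxBr -!scalemxAl -!scalemxAr !scalerA.
have E (U V : 'M[R]_1) : (U - V) 0 0 = U 0 0 - V 0 0 by rewrite !mxE.
have Z t (U : 'M[R]_1) : (t *: U) 0 0 = t * U 0 0 by rewrite !mxE.
rewrite !E !Z yx -/a -/b -/c => H.
by rewrite -subr_ge0 -(pmulr_rge0 _ a0); apply: le_trans H _; rewrite le_eqVlt; apply/orP; left; apply/eqP; ring.
Qed.

(** Moving from [x] by [t *: y], with [y = M *m x], gives the form the value [2 t s + t^2 k], where
    [s] is the squared norm of [M *m x]; a small negative [t] would make it negative unless
    [s = 0]. *)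
Lemma psd_isotropic (p : nat) (M : 'M[R]_p) (x : 'cV[R]_p) : M^T = M ->
  (forall y : 'cV[R]_p, 0 <= (y^T *m M *m y) 0 0) ->
  (x^T *m M *m x) 0 0 = 0 -> M *m x = 0.
Proof.
move=> Ms M0 xMx.
pose y := M *m x; pose s := (y^T *m y) 0 0; pose k := (y^T *m M *m y) 0 0.
have yMx : (y^T *m M *m x) 0 0 = s by rewrite /s {2}/y mulmxA.
have xMy : (x^T *m M *m y) 0 0 = s by rewrite /s {2}/y trmx_mul Ms.
have H t : 0 <= t * s *+ 2 + t ^+ 2 * k.
  have := M0 (x + t *: y).
  have -> : (x + t *: y)^T = x^T + t *: y^T by rewrite linearD linearZ.
  rewrite !mulmxDl !mulmxDr -!scalemxAl -!scalemxAr scalerA.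
  have E (U V : 'M[R]_1) : (U + V) 0 0 = U 0 0 + V 0 0 by rewrite !mxE.
  have Z b (U : 'M[R]_1) : (b *: U) 0 0 = b * U 0 0 by rewrite !mxE.
  rewrite !E !Z xMx yMx xMy; congr (_ <= _); rewrite -/k; ring.
have s_ge0 : 0 <= s by exact: sqnorm_ge0.
have k_ge0 : 0 <= k := M0 y.
have s0 : s = 0.
  apply/eqP; rewrite eq_le s_ge0 andbT leNgt; apply/negP => sp.
  have k1 : 0 < k + 1 by rewrite ltr_wpDl.
  (* Nearly the minimizer [- s / k] of the parabola; [k + 1] also covers [k = 0]. *)
  have := H (- (s / (k + 1))); rewrite leNgt => /negP; apply.
  have -> : - (s / (k + 1)) * s *+ 2 + (- (s / (k + 1))) ^+ 2 * k = - (s / (k + 1)) ^+ 2 * (k + 2).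
    by field; rewrite gt_eqF.
  rewrite mulNr oppr_lt0 mulr_gt0 ?exprn_gt0 ?divr_gt0//; lra.
by apply/eqP; rewrite -sqnorm_eq0; apply/eqP.
Qed.

Lemma eigenvalue_of_cV (p : nat) (M : 'M[R]_p) (a : R) (x : 'cV[R]_p) (tau : 'I_p -> R) :
  M^T = M -> eigenvalues_of M tau -> x != 0 -> M *m x = a *: x -> exists j, tau j = a.
Proof.
move=> Ms Mtau x0 Mx.
have : eigenvalue M a.
  apply/eigenvalueP; exists x^T; last by rewrite trmx_eq0.
  by rewrite -[M]Ms -trmx_mul Mx linearZ.
rewrite eigenvalue_root_char Mtau rootE horner_prod prodf_seq_eq0 => /hasP[j _].
by rewrite hornerXsubC subr_eq0 => /eqP ->; exists j.
Qed.

(** Let [t] be the best constant not above [c]. If [t < c], an isotropic vector of [M - t] would be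
    an eigenvector of [M] for [t], below every [tau j]; hence [M - t] is positive definite,
    dominates a positive multiple of the identity, and [t] was not the best. *)
Lemma eigenvalues_lower_bound (p : nat) (M : 'M[R]_p) (tau : 'I_p -> R) (c : R) :
  posdef M -> eigenvalues_of M tau -> (forall j, c <= tau j) -> 0 < c ->
  forall x : 'cV[R]_p, c * (x^T *m x) 0 0 <= (x^T *m M *m x) 0 0.
Proof.
move=> Mpd Mtau tauc c0.
(* The cut at [c] keeps [E] bounded even for [p = 0], where every [t] satisfies the inequality. *)
pose E := [set t : R | t <= c /\ forall x : 'cV[R]_p, t * (x^T *m x) 0 0 <= (x^T *m M *m x) 0 0].
have E0 : E 0.
  split; first exact: ltW.
  move=> x; rewrite mul0r; have [->|x0] := eqVneq x 0; first by rewrite mulmx0 mxE.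
  exact/ltW/Mpd.2.
have Eub : has_sup E by split; [exists 0 | exists c => t []].
pose t := sup E.
have tE : forall x : 'cV[R]_p, t * (x^T *m x) 0 0 <= (x^T *m M *m x) 0 0.
  move=> x; have [->|x0] := eqVneq x 0; first by rewrite !mulmx0 mxE mulr0.
  have n0 : 0 < (x^T *m x) 0 0 by rewrite lt_neqAle sqnorm_ge0 eq_sym sqnorm_eq0 x0.
  rewrite -ler_pdivlMr//; apply: ge_sup; first by exists 0.
  by move=> u [_ Hu]; rewrite ler_pdivlMr.
have tc : t <= c by apply: ge_sup; [exists 0 | move=> u []].
have [->//|tnc] := eqVneq c t.
have tltc : t < c by rewrite lt_neqAle eq_sym tnc.
exfalso.
pose N := M - t%:M.
have NE x : (x^T *m N *m x) 0 0 = (x^T *m M *m x) 0 0 - t * (x^T *m x) 0 0.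
  by rewrite /N mulmxBr mulmxBl mul_mx_scalar -scalemxAl !mxE.
have Ns : N^T = N by rewrite /N linearB /= tr_scalar_mx Mpd.1.
have Npsd (x : 'cV_p) : 0 <= (x^T *m N *m x) 0 0 by rewrite NE subr_ge0.
have Npd : posdef N.
  split=> // x x0; rewrite lt_neqAle Npsd andbT eq_sym; apply/eqP => /(psd_isotropic Ns Npsd) Nx.
  have [//|j tj] := @eigenvalue_of_cV p M t x tau Mpd.1 Mtau x0.
    by apply/eqP; rewrite -subr_eq0 -mul_scalar_mx -mulmxBl; apply/eqP.
  by have := tauc j; rewrite tj leNgt tltc.
have [A Au AN] := posdef_factor Npd.
(* [N = (A A^T)^-1] dominates a positive multiple of the identity, so [t] could be increased *)
pose k := \sum_i (row i A *m (row i A)^T) 0 0.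
have kP (z : 'cV[R]_p) : ((A *m z)^T *m (A *m z)) 0 0 <= k * (z^T *m z) 0 0.
  rewrite mxE /k mulr_suml; apply: ler_sum => i _.
  have -> : (A *m z)^T 0 i * (A *m z) i 0 = (((row i A)^T^T *m z) 0 0) ^+ 2.
    by rewrite mxE -expr2 trmxK -row_mul [in RHS]mxE.
  by rewrite -[X in (X *m _) 0 0 * _]trmxK; exact: sqdot_le.
have k_ge0 : 0 <= k.
  by apply: sumr_ge0 => i _; rewrite -[X in (X *m _) 0 0]trmxK; exact: sqnorm_ge0.
pose e := Num.min (c - t) (k + 1)^-1.
have k1 : 0 < k + 1 by rewrite ltr_wpDl.
have e0 : 0 < e by rewrite lt_min subr_gt0 tltc invr_gt0.
have : E (t + e).
  split; first by rewrite -lerBrDl ge_min lexx.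
  move=> x; rewrite mulrDl -lerBrDl -NE.
  have := kP (invmx A *m x); rewrite mulKVmx//.
  set z := invmx A *m x.
  have -> : (x^T *m N *m x) 0 0 = (z^T *m z) 0 0.
    rewrite -[x in LHS](mulKVmx Au) -/z trmx_mul.
    by rewrite -!mulmxA (mulmxA N) (mulmxA A^T) (mulmxA A^T) AN mul1mx.
  move=> H; apply: (@le_trans _ _ ((k + 1)^-1 * (x^T *m x) 0 0)).
    by apply: ler_wpM2r; rewrite ?sqnorm_ge0// ge_min lexx orbT.
  rewrite ler_pdivrMl//; apply: (le_trans H); apply: ler_wpM2r; first exact: sqnorm_ge0.
  by rewrite lerDl.
by move=> /(ub_le_sup Eub.2); rewrite -/t gerDl leNgt e0.
Qed.

(** With [x = invmx M *m y], expand the squared norm of [y - c *: x] and bound [c] times the squared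
    norm of [x] by [x^T *m M *m x = x^T *m y]. *)
Lemma inv_quadratic_bound (p : nat) (M : 'M[R]_p) (c : R) : M \in unitmx -> M^T = M -> 0 < c ->
  (forall x : 'cV[R]_p, c * (x^T *m x) 0 0 <= (x^T *m M *m x) 0 0) ->
  forall y : 'cV[R]_p, c * (y^T *m invmx M *m y) 0 0 <= (y^T *m y) 0 0.
Proof.
move=> Mu Ms c0 H y; pose x := invmx M *m y.
have yMy : (y^T *m invmx M *m y) 0 0 = (x^T *m y) 0 0.
  by rewrite /x trmx_mul trmx_inv Ms.
have yx : (y^T *m x) 0 0 = (x^T *m y) 0 0 by rewrite -yMy /x mulmxA.
have xMx : (x^T *m M *m x) 0 0 = (x^T *m y) 0 0.
  by rewrite -mulmxA /x mulKVmx.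
rewrite yMy; have := H x; rewrite xMx => Hx.
have := sqnorm_ge0 (y - c *: x).
have -> : (y - c *: x)^T = y^T - c *: x^T by rewrite linearB linearZ.
rewrite mulmxBl !mulmxBr -!scalemxAl -!scalemxAr !scalerA.
have E (U V : 'M[R]_1) : (U - V) 0 0 = U 0 0 - V 0 0 by rewrite !mxE.
have Z b (U : 'M[R]_1) : (b *: U) 0 0 = b * U 0 0 by rewrite !mxE.
rewrite !E !Z yx.
set u := (y^T *m y) 0 0; set v := (x^T *m y) 0 0; set w := (x^T *m x) 0 0.
move=> H2; have : c * (c * w) <= c * v by rewrite ler_pM2l.
rewrite -subr_ge0; rewrite -subr_ge0 => H3.
nra.
Qed.
End posdef_theory.

(** * Second and fourth moments of the standard normal law *)

Lemma addeIr_fin (R : realDomainType) (r : R) : injective (fun x : \bar R => x + r%:E)%E.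
Proof. by move=> [x| |] [y| |] //= [] /addIr ->. Qed.

Section normal_moments.
Context {R : realType}.
Let mu := @lebesgue_measure R.
Let g (x : R) := expR (- (x ^+ 2 / 2)).

Let g_ge0 x : 0 <= g x. Proof. exact: expR_ge0. Qed.

Let is_derive_g (x : R) : is_derive x 1 g (- x * g x).
Proof.
rewrite /g.
apply: is_derive_eq.
rewrite /GRing.scale /=; by field.
Qed.

Let continuous_g : continuous g.
Proof. by move=> x; apply/differentiable_continuous/derivable1_diffP; exact: ex_derive. Qed.

(** With [u = x ^+ 2 / 2], the bound [expR u >= u ^+ 2 / 2] gives [g x <= 8 / x ^+ 4], which still
    beats [x ^+ 3]. *)
Let cvg_Xg (k : nat) : (k <= 3)%N -> (x ^+ k * g x) @[x --> +oo] --> (0 : R).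
Proof.
move=> k3.
have H x : 1 <= x -> 0 <= x ^+ k * g x <= 8 * x^-1.
  move=> x1; have x0 : 0 < x by rewrite (lt_le_trans _ x1).
  rewrite mulr_ge0 ?exprn_ge0 ?(ltW x0)//=.
  have E := @expR_ge1Dxn R (x ^+ 2 / 2) 1 (divr_ge0 (sqr_ge0 _) (ler0n _ 2)).
  have {}E : x ^+ 4 / 8 <= expR (x ^+ 2 / 2).
    apply: le_trans E; rewrite (_ : (1.+1)`!%:R = 2 :> R)//.
    have -> : (x ^+ 2 / 2) ^+ 2 / 2 = x ^+ 4 / 8 by field.
    lra.
  rewrite /g expRN ler_pdivrMr ?expR_gt0//.
  apply: (@le_trans _ _ (x ^+ 3)); first exact: ler_weXn2l.
  apply: (@le_trans _ _ (8 * x^-1 * (x ^+ 4 / 8))); last first.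
    by rewrite ler_pM2l// mulr_gt0// invr_gt0.
  by rewrite le_eqVlt; apply/orP; left; apply/eqP; field; rewrite gt_eqF.
apply: (@squeeze_cvgr _ _ _ _ (cst 0) (fun x => 8 * x^-1)).
- near=> x; apply: H; near: x; exact: nbhs_pinfty_ge.
- exact: cvg_cst.
- rewrite -[X in _ --> X](mulr0 8); apply: cvgMr; apply/(@gtr0_cvgV0 R); [exact: nbhs_pinfty_gt|exact: cvg_id].
Unshelve. all: by end_near. Qed.

Let is_derive_expR1B (c x : R) :
  is_derive x 1 (fun y => - (c * expR (1 - y))) (c * expR (1 - x)).
Proof.
apply: is_derive_eq; rewrite /GRing.scale /=; ring.
Qed.

Let cvg_expR1B (c : R) : - (c * expR (1 - x)) @[x --> +oo] --> (0 : R).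
Proof.
rewrite -[X in _ --> X]oppr0; apply: cvgN.
rewrite -[X in _ --> X](mulr0 c); apply: cvgMr.
rewrite (_ : (fun x : R => expR (1 - x)) = fun x => expR 1 * expR (- x)); last first.
  by apply/funext => x; rewrite expRD.
rewrite -[X in _ --> X](mulr0 (expR 1)); apply: cvgMr.
exact: cvgr_expR.
Qed.

Let integral_half_line_derive (f F : R -> R) : (forall x, 0 <= x -> 0 <= f x) ->
  continuous f -> (forall x : R, is_derive x 1 F (f x)) -> F x @[x --> +oo] --> (0 : R) ->
  (\int[mu]_(x in `[0%R, +oo[) (f x)%:E = (- F 0)%:E)%E.
Proof.
move=> f0 cf dF Foo.
have dF1 (x : R) : derivable F x 1 by apply: (@ex_derive _ _ _ _ _ _ _ (dF x)).
rewrite (@ge0_continuous_FTC2y R f F 0 0)//.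
- by rewrite sub0e EFinN.
- exact: continuous_subspaceT.
- by apply/cvg_at_right_filter/differentiable_continuous/derivable1_diffP.
- by move=> x _; rewrite derive1E (@derive_val _ _ _ _ _ _ _ (dF x)).
Qed.

(* Adding [c * expR (1 - x)] to the derivative of [F] makes it nonnegative, as the
   fundamental theorem of calculus on a half-line requires. *)
Let integral_half_line (q : R -> R) (c : R) (F : R -> R) : 0 <= c ->
  continuous q -> (forall x, 0 <= q x) ->
  (forall x : R, is_derive x 1 F ((q x - c) * g x)) ->
  F 0 = 0 -> F x @[x --> +oo] --> (0 : R) ->
  (\int[mu]_(x in `[0%R, +oo[) (q x * g x)%:E =
   c%:E * \int[mu]_(x in `[0%R, +oo[) (g x)%:E)%E.
Proof.
move=> c0 cq q0 dF F0 Foo.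
have ce : continuous (fun x : R => c * expR (1 - x)).
  by move=> x; apply/differentiable_continuous/derivable1_diffP; exact: ex_derive.
have cf : continuous (fun x : R => (q x - c) * g x + c * expR (1 - x)).
  move=> x; apply: cvgD; last exact: ce.
  apply: cvgM; last exact: continuous_g.
  by apply: cvgB; [exact: cq|exact: cvg_cst].
have cqg : continuous (fun x : R => q x * g x).
  by move=> x; apply: cvgM; [exact: cq|exact: continuous_g].
(* The shift by 1 makes this exponential, whose primitive is explicit, dominate [g] on the whole
   line. *)
have ge x : g x <= expR (1 - x).
  rewrite /g ler_expR -subr_ge0.
  have -> : 1 - x - - (x ^+ 2 / 2) = ((x - 1) ^+ 2 + 1) / 2 by field.
  by rewrite divr_ge0// addr_ge0// sqr_ge0.
have I1 := @integral_half_line_derive (fun x => c * expR (1 - x)) (fun x => - (c * expR (1 - x)))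
  (fun x _ => mulr_ge0 c0 (expR_ge0 _)) ce (is_derive_expR1B c) (cvg_expR1B c).
have f0 x : 0 <= (q x - c) * g x + c * expR (1 - x).
  by rewrite mulrBl -addrA addr_ge0 ?mulr_ge0// addrC subr_ge0 ler_wpM2l.
have dH (x : R) : is_derive x 1 (fun x => F x + - (c * expR (1 - x)))
    ((q x - c) * g x + c * expR (1 - x)).
  exact: is_deriveD (dF x) (is_derive_expR1B c x).
have Hoo : F x + - (c * expR (1 - x)) @[x --> +oo] --> (0 : R).
  by rewrite -[X in _ --> X](addr0 0); apply: cvgD => //; exact: cvg_expR1B.
have I2 : (\int[mu]_(x in `[0%R, +oo[) ((q x - c) * g x + c * expR (1 - x))%:E = (c * expR 1)%:E)%E.
  by rewrite (integral_half_line_derive (fun x _ => f0 x) cf dH Hoo) F0 add0r opprK subr0.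
rewrite opprK subr0 in I1.
have mE (f : R -> R) : continuous f -> measurable_fun (`[0%R, +oo[ : set R) (EFin \o f).
  move=> cf'; apply/measurable_EFinP/measurable_funTS.
  exact: measurable_realfun.continuous_measurable_fun.
(* The finite number [c * expR 1], added to both sides, is read on the left as the integral of
   [c * expR (1 - x)] and on the right as that of the corrected derivative; both sides then
   integrate the same nonnegative function. *)
apply: (@addeIr_fin _ (c * expR 1)); rewrite /=.
rewrite -[in LHS]I1 -[in RHS]I2 -ge0_integralZl//; last 2 first.
- exact: mE.
- by move=> x _; rewrite lee_fin.
rewrite -ge0_integralD//; last 4 first.
- by move=> x _; rewrite lee_fin mulr_ge0.
- exact: mE.
- by move=> x _; rewrite lee_fin mulr_ge0// expR_ge0.
- exact: mE.
rewrite -ge0_integralD//.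
- by apply: eq_integral => x _; rewrite -!EFinM -!EFinD; congr EFin; ring.
- by move=> x _; rewrite -EFinM lee_fin mulr_ge0.
- by apply: measurable_funeM; exact: mE.
- by move=> x _; rewrite lee_fin.
- exact: mE.
Qed.

(** Since [(q - c) g] has a primitive vanishing at 0 and at infinity, [q g] and [c g] have the same
    integral on the half-line, hence by parity on the line. Normalization of the density then leaves
    [c], so the integral of [g] is never computed. *)
Let integral_even (q : R -> R) (c : R) (F : R -> R) : 0 <= c ->
  continuous q -> (forall x, 0 <= q x) -> (forall x, q (- x) = q x) ->
  (forall x : R, is_derive x 1 F ((q x - c) * g x)) ->
  F 0 = 0 -> F x @[x --> +oo] --> (0 : R) ->
  (\int[mu]_x (q x * normal_pdf 0 1 x)%:E = c%:E)%E.
Proof.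
move=> c0 cq q0 qN dF F0 Foo.
have pdfE x : normal_pdf 0 1 x = normal_peak 1 * g x.
  rewrite normal_pdfE ?oner_eq0// /normal_fun /g; congr (_ * expR _).
  by rewrite subr0 expr1n mulNr.
have k0 : 0 <= normal_peak (1 : R) by exact: normal_peak_ge0.
have gN x : g (- x) = g x by rewrite /g sqrrN.
have cqg : continuous (fun x : R => q x * g x).
  by move=> x; apply: cvgM; [exact: cq|exact: continuous_g].
have mE (f : R -> R) : continuous f -> measurable_fun setT (EFin \o f).
  by move=> cf'; apply/measurable_EFinP; exact: measurable_realfun.continuous_measurable_fun.
have H : (\int[mu]_x (q x * g x)%:E = c%:E * \int[mu]_x (g x)%:E)%E.
  rewrite (@ge0_symfun_integralT R (fun x => q x * g x))//; last 2 first.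
  - by move=> x; rewrite mulr_ge0.
  - by move=> x /=; rewrite qN gN.
  rewrite [in RHS](@ge0_symfun_integralT R g)//; last by move=> x /=; rewrite gN.
  by rewrite -set_itvcy (integral_half_line c0 cq q0 dF F0 Foo) muleCA.
transitivity (c%:E * \int[mu]_x (normal_pdf 0 1 x)%:E)%E; last first.
  by rewrite integral_normal_pdf mule1.
under eq_integral do rewrite pdfE mulrCA EFinM.
rewrite ge0_integralZl//; last 2 first.
- exact: mE.
- by move=> x _; rewrite lee_fin mulr_ge0.
under [in RHS]eq_integral do rewrite pdfE EFinM.
rewrite ge0_integralZl//; last 2 first.
- exact: mE.
- by move=> x _; rewrite lee_fin.
by rewrite H muleCA.
Qed.

Lemma std_normal_moment2 : (\int[mu]_x (x ^+ 2 * normal_pdf 0 1 x)%:E = 1%:E)%E.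
Proof.
apply: (@integral_even (fun x => x ^+ 2) 1 (fun x => - (x * g x))) => //.
- exact: exprn_continuous.
- by move=> x; exact: sqr_ge0.
- by move=> x; rewrite sqrrN.
- by move=> x; have dg := is_derive_g x; apply: is_derive_eq; rewrite /GRing.scale /=; ring.
- by rewrite mul0r oppr0.
- by rewrite -[X in _ --> X]oppr0; apply: cvgN; exact: (@cvg_Xg 1).
Qed.

Lemma std_normal_moment4 : (\int[mu]_x (x ^+ 4 * normal_pdf 0 1 x)%:E = 3%:E)%E.
Proof.
(* [(x^3 g)' = (3 x^2 - x^4) g] and [3 (x g)' = (3 - 3 x^2) g]: the terms in [x^2] cancel in the
   sum. *)
apply: (@integral_even (fun x => x ^+ 4) 3 (fun x => - (x ^+ 3 * g x + 3 * (x * g x)))) => //.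
- exact: exprn_continuous.
- by move=> x; rewrite exprn_even_ge0.
- by move=> x; rewrite exprNn -signr_odd mul1r.
- by move=> x; have dg := is_derive_g x; apply: is_derive_eq; rewrite /GRing.scale /=; ring.
- by rewrite expr0n !mul0r mulr0 addr0 oppr0.
- rewrite -[X in _ --> X]oppr0; apply: cvgN.
  rewrite -[X in _ --> X](addr0 0); apply: cvgD; first exact: (@cvg_Xg 3).
  by rewrite -[X in _ --> X](mulr0 3); apply: cvgMr; exact: (@cvg_Xg 1).
Qed.

(** The change of variables is available for the Radon--Nikodym derivative, which agrees almost
    everywhere with [normal_pdf] because both have the same integral over every measurable set. *)
Lemma ge0_integral_normal_prob (m s : R) (f : R -> \bar R) : (forall x, 0 <= f x)%E ->
  measurable_fun setT f ->
  (\int[normal_prob m s]_x f x = \int[mu]_x (f x * (normal_pdf m s x)%:E))%E.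
Proof.
move=> f0 mf.
rewrite -(Radon_Nikodym_SigmaFinite.change_of_variables (normal_prob_dominates m s) f0 measurableT mf).
apply: ae_eq_integral => //.
- apply: emeasurable_funM => //.
  exact: measurable_int (Radon_Nikodym_SigmaFinite.f_integrable (normal_prob_dominates m s)).
- apply: emeasurable_funM => //; apply/measurable_EFinP; exact: measurable_normal_pdf.
apply: ae_eqe_mul2l; apply: integral_ae_eq => //.
- exact: (Radon_Nikodym_SigmaFinite.f_integrable (normal_prob_dominates m s)).
- by apply/measurable_EFinP; exact: measurable_normal_pdf.
- by move=> E _ mE; rewrite -(Radon_Nikodym_SigmaFinite.f_integral (normal_prob_dominates m s)).
Qed.
End normal_moments.

(** * Variance of a sum of pairwise uncorrelated nonnegative variables *)

Section second_moments.
Context {R : realType} {d : measure_display} {T : measurableType d}.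
Variable P : probability T R.

Lemma ge0_integral_sumEFin (I : Type) (s : seq I) (f : I -> T -> R) :
  (forall i, measurable_fun setT (f i)) -> (forall i w, 0 <= f i w) ->
  (\int[P]_w (\sum_(i <- s) f i w)%:E = \sum_(i <- s) \int[P]_w (f i w)%:E)%E.
Proof.
move=> mf f0; under eq_integral do rewrite -sumEFin.
rewrite ge0_integral_sum//.
- by move=> i; apply/measurable_EFinP.
- by move=> i w _; rewrite lee_fin.
Qed.

(** In the expanded square, diagonal products carry [mu^2 + v] and the others [mu^2], so the second
    moment is [(m mu)^2 + m v]. Centering goes through [(S - N)^2 + 2 N S = S^2 + N^2], whose terms
    are all nonnegative, so no integrability has to be known beforehand. *)
Lemma variance_sum (m : nat) (F : 'I_m -> T -> R) (mu v : R) : 0 <= mu ->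
  (forall j, measurable_fun setT (F j)) -> (forall j w, 0 <= F j w) ->
  (forall j, \int[P]_w (F j w)%:E = mu%:E)%E ->
  (forall j, \int[P]_w ((F j w) ^+ 2)%:E = (mu ^+ 2 + v)%:E)%E ->
  (forall j k, j != k -> \int[P]_w (F j w * F k w)%:E = (mu ^+ 2)%:E)%E ->
  (\int[P]_w ((\sum_j F j w - m%:R * mu) ^+ 2)%:E = (m%:R * v)%:E)%E.
Proof.
move=> mu0 mF F0 EF EF2 EFF.
pose S w := \sum_j F j w; pose N := m%:R * mu.
have mS : measurable_fun setT S by exact: measurable_sum.
have S0 w : 0 <= S w by exact: sumr_ge0.
have N0 : 0 <= N by rewrite mulr_ge0.
have ES : (\int[P]_w (S w)%:E = N%:E)%E.
  rewrite ge0_integral_sumEFin//; under eq_bigr do rewrite EF.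
  by rewrite sumEFin sumr_const card_ord -mulr_natl.
have ES2 : (\int[P]_w ((S w) ^+ 2)%:E = (N ^+ 2 + m%:R * v)%:E)%E.
  have SS w : S w ^+ 2 = \sum_j \sum_k F j w * F k w.
    by rewrite expr2 /S mulr_suml; apply: eq_bigr => j _; rewrite mulr_sumr.
  under eq_integral do rewrite SS.
  rewrite ge0_integral_sumEFin; last 2 first.
  - by move=> j; apply: measurable_sum => k; exact: measurable_funM.
  - by move=> j w; apply: sumr_ge0 => k _; exact: mulr_ge0.
  have E1 (j : 'I_m) : (\int[P]_w (\sum_k F j w * F k w)%:E = (m%:R * mu ^+ 2 + v)%:E)%E.
    rewrite ge0_integral_sumEFin; last 2 first.
    - by move=> k; exact: measurable_funM.
    - by move=> k w; exact: mulr_ge0.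
    have E2 k : (\int[P]_w (F j w * F k w)%:E = (mu ^+ 2 + (if j == k then v else 0))%:E)%E.
      have [<-|jk] := eqVneq j k; first by rewrite -(EF2 j).
      by rewrite addr0 EFF.
    under eq_bigr do rewrite E2.
    rewrite sumEFin big_split /= sumr_const card_ord mulr_natl; congr (_ + _)%:E.
    by rewrite -big_mkcond /= (big_pred1 j)// => i; rewrite eq_sym.
  under eq_bigr do rewrite E1.
  rewrite sumEFin sumr_const card_ord -mulr_natl /N; congr EFin; ring.
have key : (\int[P]_w ((S w - N) ^+ 2)%:E + (2 * N)%:E * \int[P]_w (S w)%:E =
            \int[P]_w ((S w) ^+ 2)%:E + (N ^+ 2)%:E)%E.
  rewrite -ge0_integralZl//; last 3 first.
  - by apply/measurable_EFinP.
  - by move=> w _; rewrite lee_fin.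
  - by rewrite lee_fin mulr_ge0.
  rewrite -ge0_integralD//; last 4 first.
  - by move=> w _; rewrite lee_fin sqr_ge0.
  - apply/measurable_EFinP/measurable_funX; exact: measurable_funB.
  - by move=> w _; rewrite -EFinM lee_fin !mulr_ge0.
  - by apply/measurable_EFinP/measurable_funM.
  have -> : ((N ^+ 2)%:E = \int[P]_w (N ^+ 2)%:E)%E.
    by rewrite integral_cst//= probability_setT mule1.
  rewrite -ge0_integralD//; last 3 first.
  - by move=> w _; rewrite lee_fin sqr_ge0.
  - exact/measurable_EFinP/measurable_funX.
  - by move=> w _; rewrite lee_fin sqr_ge0.
  by apply: eq_integral => w _; rewrite -EFinM -!EFinD; congr EFin; ring.
move: key; rewrite ES ES2 -/(S _) -/N.
rewrite (_ : (fun w => _) = (fun w => ((S w - N) ^+ 2)%:E))//.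
case: (\int[P]_w ((S w - N) ^+ 2)%:E)%E => [r| |] //.
rewrite -EFinM -!EFinD => -[H]; congr EFin; lra.
Qed.
End second_moments.

(** * Moments of the squared norm of a whitened Gaussian vector *)

Section gaussian_vectors.
Context {R : realType} {d : measure_display} {T : measurableType d}.
Variables (P : probability T R) (p : nat) (X : T -> 'cV[R]_p) (Psi : 'M[R]_p).
Hypothesis GX : gaussian_vec P X Psi.

Let L (a : 'cV[R]_p) (w : T) : R := (a^T *m X w) 0 0.

Lemma measurable_linear_form (a : 'cV[R]_p) : measurable_fun setT (L a).
Proof.
rewrite (_ : L a = fun w => \sum_i a i 0 * X w i 0); last first.
  by apply/funext => w; rewrite /L mxE; apply: eq_bigr => i _; rewrite mxE.
apply: measurable_sum => i; apply: measurable_funM => //; exact: GX.1.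
Qed.

Let E_form (a : 'cV[R]_p) (f : R -> R) : (a^T *m Psi *m a) 0 0 = 1 ->
  measurable_fun setT f -> (forall x, 0 <= f x) ->
  (\int[P]_w (f (L a w))%:E = \int[lebesgue_measure]_x (f x * normal_pdf 0 1 x)%:E)%E.
Proof.
move=> a1 mf f0.
have mL := measurable_linear_form a.
have aN0 : a != 0.
  by apply/eqP => a0; move: a1; rewrite a0 mulmx0 mxE => /eqP; rewrite eq_sym oner_eq0.
(* [R] and [measurableTypeR R], on which [normal_prob] lives, carry the same measurable
   sets under different displays. *)
have mL' : measurable_fun setT (L a : T -> measurableTypeR R) := mL.
pose Lm : {mfun T >-> measurableTypeR R} := HB.pack (L a : T -> measurableTypeR R)
  (isMeasurableFun.Build _ _ T (measurableTypeR R) _ mL').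
have mfE : measurable_fun (setT : set (measurableTypeR R)) (EFin \o f) by exact/measurable_EFinP.
have := @ge0_integral_distribution _ _ _ _ _ P Lm _ mfE.
rewrite /comp /= => <-; last by move=> x; rewrite lee_fin.
transitivity (\int[normal_prob 0 1]_x (f x)%:E)%E.
  apply: eq_measure_integral => B mB _.
  have H := GX.2 a aN0 B mB; rewrite a1 sqrtr1 in H; apply: etrans H.
  rewrite /= /distribution /pushforward; congr (P _); apply/seteqP.
  by split=> w /=; rewrite in_setE.
by rewrite ge0_integral_normal_prob// => x; rewrite lee_fin.
Qed.

Let E_form2 (a : 'cV[R]_p) : (a^T *m Psi *m a) 0 0 = 1 ->
  (\int[P]_w ((L a w) ^+ 2)%:E = 1%:E)%E.
Proof.
move=> a1; rewrite (E_form (f := fun x => x ^+ 2))//; first exact: std_normal_moment2.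
by move=> x; exact: sqr_ge0.
Qed.

Let E_form4 (a : 'cV[R]_p) : (a^T *m Psi *m a) 0 0 = 1 ->
  (\int[P]_w ((L a w) ^+ 4)%:E = 3%:E)%E.
Proof.
move=> a1; rewrite (E_form (f := fun x => x ^+ 4))//; first exact: std_normal_moment4.
by move=> x; rewrite exprn_even_ge0.
Qed.

(* Polarization: with [x = L a] and [y = L b],
   [((x + y) / sqrt 2)^4 + ((x - y) / sqrt 2)^4 = (x^4 + 6 x^2 y^2 + y^4) / 2],
   and all three linear forms are standard normal. *)
Let E_form22 (a b : 'cV[R]_p) : (a^T *m Psi *m a) 0 0 = 1 -> (b^T *m Psi *m b) 0 0 = 1 ->
  (a^T *m Psi *m b) 0 0 = 0 -> (b^T *m Psi *m a) 0 0 = 0 ->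
  (\int[P]_w ((L a w) ^+ 2 * (L b w) ^+ 2)%:E = 1%:E)%E.
Proof.
move=> aa bb ab ba.
pose c : R := (Num.sqrt 2)^-1.
have c2 : c ^+ 2 = 2^-1 by rewrite exprVn sqr_sqrtr.
have c4 : c ^+ 4 = 4^-1 by rewrite (exprM c 2 2) c2; field.
pose u s := c *: (a + s *: b).
have E0 (U V : 'M[R]_1) : (U + V) 0 0 = U 0 0 + V 0 0 by rewrite !mxE.
have Z0 s (U : 'M[R]_1) : (s *: U) 0 0 = s * U 0 0 by rewrite !mxE.
have uT s : (u s)^T = c *: (a^T + s *: b^T).
  by apply/matrixP => i j; rewrite !mxE.
have uu s : s ^+ 2 = 1 -> ((u s)^T *m Psi *m u s) 0 0 = 1.
  move=> s2; rewrite uT /u -!scalemxAl -!scalemxAr !mulmxDl !mulmxDr.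
  rewrite -!scalemxAl -!scalemxAr !(E0, Z0) aa bb ab ba.
  have -> : c * (c * (1 + s * 0 + (s * 0 + s * (s * 1)))) = c ^+ 2 * (1 + s ^+ 2) by ring.
  by rewrite c2 s2; field.
have Lu s w : L (u s) w = c * (L a w + s * L b w).
  by rewrite /L uT -!scalemxAl !mulmxDl -!scalemxAl !(E0, Z0).
have mL := measurable_linear_form.
have I1 := E_form4 (uu 1 (expr1n _ _)).
have I2 := E_form4 (uu (-1) (etrans (sqrrN _) (expr1n _ _))).
have key : (\int[P]_w ((L (u 1) w) ^+ 4)%:E + \int[P]_w ((L (u (-1)) w) ^+ 4)%:E =
  2^-1%:E * \int[P]_w ((L a w) ^+ 4)%:E + (3%:E * \int[P]_w ((L a w) ^+ 2 * (L b w) ^+ 2)%:E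
    + 2^-1%:E * \int[P]_w ((L b w) ^+ 4)%:E))%E.
  have m4 e : measurable_fun setT (fun w => (L e w ^+ 4)%:E).
    by apply/measurable_EFinP/measurable_funX.
  have p4 e w : (0 <= (L e w ^+ 4)%:E)%E by rewrite lee_fin exprn_even_ge0.
  have p22 w : (0 <= (L a w ^+ 2 * L b w ^+ 2)%:E)%E by rewrite lee_fin mulr_ge0// sqr_ge0.
  have m22 : measurable_fun setT (fun w => (L a w ^+ 2 * L b w ^+ 2)%:E).
    by apply/measurable_EFinP/measurable_funM; apply/measurable_funX.
  rewrite -!ge0_integralZl//.
  rewrite -!ge0_integralD//; first last.
  - by apply: measurable_funeM.
  - by move=> w _; rewrite -EFinM lee_fin mulr_ge0// -lee_fin.
  - by apply: measurable_funeM.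
  - by move=> w _; rewrite -EFinM lee_fin mulr_ge0// -lee_fin.
  - by apply: emeasurable_funD; apply: measurable_funeM.
  - by move=> w _; rewrite -!EFinM -EFinD lee_fin addr_ge0// mulr_ge0// -lee_fin.
  - by apply: measurable_funeM.
  - by move=> w _; rewrite -EFinM lee_fin mulr_ge0// -lee_fin.
  apply: eq_integral => w _; rewrite -!EFinM -!EFinD; congr EFin.
  by rewrite !Lu !exprMn c4; field.
move: key; rewrite I1 I2 (E_form4 aa) (E_form4 bb).
case: (\int[P]_w (L a w ^+ 2 * L b w ^+ 2)%:E)%E => [r| |].
(* The identity reads [3 + 3 = 3 / 2 + 3 * r + 3 / 2]; an infinite middle term would contradict the
   finite left side. *)
- by rewrite -!EFinM -!EFinD => -[H]; congr EFin; lra.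
- by rewrite gt0_muley ?lte_fin// -!EFinM -EFinD.
- by rewrite gt0_muleNy ?lte_fin// -!EFinM -EFinD.
Qed.

Variable A : 'M[R]_p.
Hypothesis APsi : A^T *m Psi *m A = 1%:M.

Let Z i w := (A^T *m X w) i 0.

Let ZE i w : Z i w = L (col i A) w.
Proof. by rewrite /Z /L !mxE; apply: eq_bigr => k _; rewrite !mxE. Qed.

(** Orthonormality for [Psi] is what the moment computations above ask of the coefficient vectors of
    the linear forms. *)
Let colA i k : ((col i A)^T *m Psi *m col k A) 0 0 = (i == k)%:R.
Proof.
have -> : ((col i A)^T *m Psi *m col k A) = row i (A^T *m Psi *m A) *m delta_mx k 0.
  by rewrite tr_col (colE k A) !row_mul !mulmxA.
by rewrite APsi -colE !mxE.
Qed.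

Let mZ i : measurable_fun setT (Z i).
Proof.
rewrite (_ : Z i = L (col i A)); last by apply/funext => w; rewrite ZE.
exact: measurable_linear_form.
Qed.

Lemma measurable_whitened_sqnorm :
  measurable_fun setT (fun w => \sum_i ((A^T *m X w) i 0) ^+ 2).
Proof. by apply: measurable_sum => i; apply: measurable_funX; exact: mZ. Qed.

Lemma whitened_sqnorm_moment1 :
  (\int[P]_w (\sum_i ((A^T *m X w) i 0) ^+ 2)%:E = p%:R%:E)%E.
Proof.
rewrite ge0_integral_sumEFin; last 2 first.
- by move=> i; apply: measurable_funX; exact: mZ.
- by move=> i w; exact: sqr_ge0.
have E1 (i : 'I_p) : (\int[P]_w ((A^T *m X w) i 0 ^+ 2)%:E = 1%:E)%E.
  under eq_integral do rewrite -/(Z i _) ZE.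
  by rewrite E_form2// colA eqxx.
by under eq_bigr do rewrite E1; rewrite sumEFin sumr_const card_ord.
Qed.

(** In the double sum each row has one fourth moment 3 and [p - 1] mixed moments 1, that is [p + 2];
    there are [p] rows. *)
Lemma whitened_sqnorm_moment2 :
  (\int[P]_w ((\sum_i ((A^T *m X w) i 0) ^+ 2) ^+ 2)%:E = (p%:R ^+ 2 + 2 * p%:R)%:E)%E.
Proof.
have SS w : (\sum_i ((A^T *m X w) i 0) ^+ 2) ^+ 2 = \sum_i \sum_k Z i w ^+ 2 * Z k w ^+ 2.
  by rewrite expr2 mulr_suml; apply: eq_bigr => j _; rewrite mulr_sumr.
under eq_integral do rewrite SS.
have mZZ i k : measurable_fun setT (fun w => Z i w ^+ 2 * Z k w ^+ 2).
  by apply: measurable_funM; apply: measurable_funX; exact: mZ.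
have ZZ0 i k w : 0 <= Z i w ^+ 2 * Z k w ^+ 2 by rewrite mulr_ge0 ?sqr_ge0.
rewrite ge0_integral_sumEFin; last 2 first.
- by move=> i; exact: measurable_sum.
- by move=> i w; exact: sumr_ge0.
have E2 i k : (\int[P]_w (Z i w ^+ 2 * Z k w ^+ 2)%:E = (1 + (if i == k then 2 else 0))%:E)%E.
  have [<-|ik] := eqVneq i k.
    under eq_integral do rewrite -exprD ZE.
    by rewrite E_form4 ?colA ?eqxx//; congr EFin; ring.
  under eq_integral do rewrite !ZE.
  by rewrite E_form22 ?addr0// colA ?eqxx// ?(negbTE ik)// eq_sym (negbTE ik).
have E1 (i : 'I_p) : (\int[P]_w (\sum_k Z i w ^+ 2 * Z k w ^+ 2)%:E = (p%:R + 2)%:E)%E.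
  rewrite ge0_integral_sumEFin//.
  under eq_bigr do rewrite E2.
  rewrite sumEFin big_split /= sumr_const card_ord; congr (_ + _)%:E.
  by rewrite -big_mkcond /= (big_pred1 i)// => k; rewrite eq_sym.
under eq_bigr do rewrite E1.
rewrite sumEFin sumr_const card_ord -mulr_natl; congr EFin; ring.
Qed.
End gaussian_vectors.

(** * Independence: from generating families to expectations of products *)

Section independence.
Context {R : realType} {d : measure_display} {T : measurableType d}.
Variable P : probability T R.

(** For fixed [B], both sides are finite measures in [A] that agree on the pi-system [G]; [g] is the
    exhausting sequence required by uniqueness of measures. *)
Lemma indep_generatedl (G : set (set T)) (g : (set T)^nat) (B : set T) :
  G `<=` measurable -> setI_closed G -> (forall n, G (g n)) -> \bigcup_n g n = setT ->
  measurable B -> (forall A, G A -> P (A `&` B) = (P A * P B)%E) ->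
  forall A, <<s G >> A -> P (A `&` B) = (P A * P B)%E.
Proof.
move=> mG GI Gg gT mB GB A sA.
pose r : {nonneg R} := NngNum (fine_ge0 (measure_ge0 P B)).
have PB : (r%:num)%:E = P B by rewrite /= fineK// fin_num_measure.
have E : mrestr P mB A = mscale r P A.
  apply: (@g_sigma_algebra_measure_unique _ R T G mG g Gg gT (mrestr P mB) (mscale r P) GI) => //.
  - by move=> C GC; rewrite /= /mrestr /mscale PB muleC; exact: GB.
  - move=> k; rewrite /= /mrestr (le_lt_trans (probability_le1 _ _)) ?ltry//.
    by apply: measurableI => //; exact/mG.
by move: E; rewrite /= /mrestr /mscale PB muleC.
Qed.

Lemma indep_generated (G1 G2 : set (set T)) (g1 g2 : (set T)^nat) :
  G1 `<=` measurable -> setI_closed G1 -> (forall n, G1 (g1 n)) -> \bigcup_n g1 n = setT ->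
  G2 `<=` measurable -> setI_closed G2 -> (forall n, G2 (g2 n)) -> \bigcup_n g2 n = setT ->
  (forall A B, G1 A -> G2 B -> P (A `&` B) = (P A * P B)%E) ->
  forall A B, <<s G1 >> A -> <<s G2 >> B -> P (A `&` B) = (P A * P B)%E.
Proof.
move=> mG1 I1 Gg1 T1 mG2 I2 Gg2 T2 H A B sA sB.
have mA : measurable A := smallest_sub (@sigma_algebra_measurable _ T) mG1 sA.
rewrite setIC muleC.
apply: (indep_generatedl mG2 I2 Gg2 T2 mA) sB => C G2C.
rewrite setIC muleC.
by apply: (indep_generatedl mG1 I1 Gg1 T1 (mG2 _ G2C)) sA => D G1D; exact: H.
Qed.

(** The law of the pair agrees with the product of the laws on rectangles, hence everywhere, and
    Tonelli's theorem separates the integral. *)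
Lemma indep_expectationM (X Y : T -> R) :
  measurable_fun setT X -> measurable_fun setT Y ->
  (forall w, 0 <= X w) -> (forall w, 0 <= Y w) ->
  (forall A B : set R, measurable A -> measurable B ->
     P (X @^-1` A `&` Y @^-1` B) = (P (X @^-1` A) * P (Y @^-1` B))%E) ->
  (\int[P]_w (X w * Y w)%:E = \int[P]_w (X w)%:E * \int[P]_w (Y w)%:E)%E.
Proof.
move=> mX mY X0 Y0 XY.
pose x : {RV P >-> R} := HB.pack X (isMeasurableFun.Build _ _ _ _ _ mX).
pose y : {RV P >-> R} := HB.pack Y (isMeasurableFun.Build _ _ _ _ _ mY).
have mXY : measurable_fun setT (fun w => (X w, Y w)) by exact: measurable_fun_pair.
pose xy : {mfun T >-> (R * R)%type} := HB.pack (fun w => (X w, Y w)) (isMeasurableFun.Build _ _ _ _ _ mXY).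
(* The positive part makes the integrand nonnegative on the whole plane without changing it at
   values of [X] and [Y]. *)
pose h (r : R) : \bar R := (Num.max r 0)%:E.
have h0 r : (0 <= h r)%E by rewrite lee_fin le_max lexx orbT.
have mh : measurable_fun setT h.
  by apply/measurable_EFinP; apply: measurable_maxr.
pose f (z : R * R) : \bar R := (h z.1 * h z.2)%E.
have f0 z : (0 <= f z)%E by rewrite mule_ge0.
have mf : measurable_fun setT f.
  by apply: emeasurable_funM; apply: measurableT_comp.
have hX w : h (X w) = (X w)%:E by rewrite /h max_l.
have hY w : h (Y w) = (Y w)%:E by rewrite /h max_l.
have E1 : (\int[P]_w (X w * Y w)%:E = \int[distribution P xy]_z f z)%E.
  rewrite ge0_integral_distribution//.
  by apply: eq_integral => w _; rewrite /f /= hX hY EFinM.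
rewrite E1.
have -> : (\int[distribution P xy]_z f z = \int[distribution P x \x distribution P y]_z f z)%E.
  apply: eq_measure_integral => C mC _; apply/esym.
  apply: product_measure_unique => //.
rewrite fubini_tonelli1//= /fubini_F /f /=.
under eq_integral do rewrite ge0_integralZl//.
rewrite ge0_integralZr//; last by apply: integral_ge0.
rewrite !ge0_integral_distribution//.
by congr (_ * _)%E; apply: eq_integral => w _ /=; rewrite ?hX ?hY.
Qed.

End independence.

(** * Pairwise independence of the columns *)

Section independent_columns.
Context {R : realType} {d : measure_display} {T : measurableType d}.
Variables (P : probability T R) (p m : nat) (Y : T -> 'M[R]_(p, m)).
Hypothesis mY : forall i j, measurable_fun setT (fun w => Y w i j).
Hypothesis YI : indep_columns P Y.

(** Orthants of one column form a pi-system generating the events of that column, and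
    [indep_columns] is a formula about them. *)
Let orth (j : 'I_m) (t : 'cV[R]_p) : set T := [set w | forall i, Y w i j <= t i 0].

Let G (j : 'I_m) : set (set T) := range (orth j).

Let morth j t : measurable (orth j t).
Proof.
rewrite (_ : orth j t = \bigcap_(i in [set: 'I_p]) [set w | Y w i j <= t i 0]); last first.
  by apply/seteqP; split=> [w H i _|w H i]; [exact: H|exact: (H i I)].
apply: fin_bigcap_measurable => //= i _.
rewrite (_ : [set w | _] = setT `&` (fun w => Y w i j) @^-1` `]-oo, t i 0]); last first.
  by rewrite setTI; apply/seteqP; split=> w; rewrite /= in_itv.
exact: mY.
Qed.

Let level (n : nat) : 'cV[R]_p := const_mx n%:R.

Let level_cover w : exists n, forall i j, Y w i j <= (level n) i 0.
Proof.
exists (Num.bound (\sum_i \sum_j `|Y w i j|)) => i j; rewrite mxE.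
apply: (@le_trans _ _ (\sum_i \sum_j `|Y w i j|)); last first.
  apply/ltW/archi_boundP; apply: sumr_ge0 => ? _; exact: sumr_ge0.
rewrite (bigD1 i)//= (bigD1 j)//= -addrA (le_trans (ler_norm _))// lerDl.
by rewrite addr_ge0 ?sumr_ge0// => *; rewrite sumr_ge0.
Qed.

Let orth_cover j : \bigcup_n orth j (level n) = setT.
Proof.
by apply/seteqP; split => // w _; have [n Hn] := level_cover w; exists n.
Qed.

Let GI j : setI_closed (G j).
Proof.
move=> _ _ [s _ <-] [t _ <-]; exists (\col_i Num.min (s i 0) (t i 0)) => //.
apply/seteqP; split => [w H|w [H1 H2] i].
  by split=> i; have := H i; rewrite mxE le_min => /andP[].
by rewrite mxE le_min H1 H2.
Qed.

Let allorth (t : 'I_m -> 'cV[R]_p) : set T := [set w | forall j i, Y w i j <= t j i 0].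

Let mallorth t : measurable (allorth t).
Proof.
rewrite (_ : allorth t = \bigcap_(j in [set: 'I_m]) orth j (t j)); last first.
  by apply/seteqP; split=> [w H j _ i|w H j i]; [exact: H|exact: (H j I i)].
by apply: fin_bigcap_measurable => //= j _; exact: morth.
Qed.

Let pr (A : set T) : R := fine (P A).

Let prE A : measurable A -> P A = (pr A)%:E.
Proof. by move=> mA; rewrite /pr fineK// fin_num_measure. Qed.

Let pr_allorth t : pr (allorth t) = \prod_j pr (orth j (t j)).
Proof.
apply: EFin_inj; rewrite -prE// YI (big_morph EFin EFinM erefl).
by apply: eq_bigr => j _; rewrite -prE.
Qed.

Let pr_ge0 A : 0 <= pr A. Proof. exact: fine_ge0. Qed.

Let pr_le1 A : measurable A -> pr A <= 1.
Proof. by move=> mA; rewrite -lee_fin -prE// probability_le1. Qed.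

Let cvg_pr (A : (set T)^nat) (B : set T) : (forall n, measurable (A n)) -> measurable B ->
  nondecreasing_seq A -> \bigcup_n A n = B -> pr (A n) @[n --> \oo] --> pr B.
Proof.
move=> mA mB ndA AB.
have := @nondecreasing_cvg_mu _ _ _ P A mA _ ndA; rewrite AB => /(_ mB) H.
by apply: fine_cvg; rewrite -prE.
Qed.

(* The bounds on the columns other than [j] and [k] are sent to infinity. *)
Let indep_orth j k s t : j != k ->
  P (orth j s `&` orth k t) = (P (orth j s) * P (orth k t))%E.
Proof.
move=> jk.
pose lv n (l : 'I_m) := if l == j then s else if l == k then t else level n.
pose a := pr (orth j s) * pr (orth k t).
(* The factor left by the other columns: at most 1, and at least the probability that every column
   lies below [level n], which tends to 1. *)
pose b n := \prod_(l | (l != j) && (l != k)) pr (orth l (level n)).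
have E1 n : pr (allorth (lv n)) = a * b n.
  rewrite pr_allorth (bigD1 j)//= (bigD1 k) ?(eq_sym k)//= mulrA; congr (_ * _ * _).
  - by rewrite /lv eqxx.
  - by rewrite /lv (eq_sym k) (negbTE jk) eqxx.
  - by apply: eq_bigr => l /andP[lj lk]; rewrite /lv (negbTE lj) (negbTE lk).
have b0 n : 0 <= b n by exact: prodr_ge0.
have b1 n : b n <= 1.
  apply: (@le_trans _ _ (\prod_(l | (l != j) && (l != k)) 1)); last by rewrite big1.
  by apply: ler_prod => l _; rewrite pr_ge0 pr_le1.
have bge n : pr (allorth (fun _ => level n)) <= b n.
  rewrite pr_allorth (bigD1 j)//= (bigD1 k) ?(eq_sym k)//= -/(b n) mulrA.
  by rewrite ler_piMl// mulr_ile1 ?pr_le1.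
have cb : pr (allorth (fun _ => level n)) @[n --> \oo] --> (1 : R).
  have -> : 1 = pr setT by rewrite /pr probability_setT.
  apply: cvg_pr => //.
  - move=> n l nl; apply/subsetPset => w H i q; apply: (le_trans (H i q)).
    by rewrite !mxE ler_nat.
  - by apply/seteqP; split => // w _; have [n Hn] := level_cover w; exists n => // q i; exact: Hn.
have ca : pr (allorth (lv n)) @[n --> \oo] --> pr (orth j s `&` orth k t).
  apply: cvg_pr => //.
  - by apply: measurableI.
  - move=> n l nl; apply/subsetPset => w H q i; apply: (le_trans (H q i)).
    by rewrite /lv; case: ifP => // _; case: ifP => // _; rewrite !mxE ler_nat.
  - apply/seteqP; split => [w [n _ H]|w [H1 H2]].
      split=> i; first by have := H j i; rewrite /lv eqxx.
      by have := H k i; rewrite /lv (eq_sym k) (negbTE jk) eqxx.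
    have [n Hn] := level_cover w; exists n => // q i; rewrite /lv.
    by case: eqVneq => [->//|_]; case: eqVneq => [->//|_].
have bc : b n @[n --> \oo] --> (1 : R).
  apply: (@squeeze_cvgr _ _ _ _ (fun n => pr (allorth (fun _ => level n))) (cst 1)) => //.
  - by apply: nearW => n; rewrite bge b1.
  - exact: cvg_cst.
have ca' : pr (allorth (lv n)) @[n --> \oo] --> a.
  rewrite (_ : (fun n => pr (allorth (lv n))) = fun n => a * b n); last exact/funext.
  by rewrite -[X in _ --> X]mulr1; apply: cvgMr.
have -> := prE (measurableI _ _ (morth j s) (morth k t)).
rewrite !prE// -EFinM; congr EFin.
exact: (cvg_unique _ ca ca').
Qed.

Let Gmeas j : G j `<=` measurable.
Proof. by move=> _ [t _ <-]; exact: morth. Qed.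

(** Measurability of [f] is quantified over all measurable spaces because it is also used on [T]
    with the smaller sigma-algebra generated by the orthants of one column; this places the
    preimages under [f] of that column where independence is known. *)
Lemma indep_columns_expectationM (f : 'cV[R]_p -> R) (j k : 'I_m) : j != k ->
  (forall x, 0 <= f x) ->
  (forall (d' : measure_display) (S : measurableType d') (X : S -> 'cV[R]_p),
     (forall i, measurable_fun setT (fun w => X w i 0)) -> measurable_fun setT (fun w => f (X w))) ->
  (\int[P]_w (f (col j (Y w)) * f (col k (Y w)))%:E =
   \int[P]_w (f (col j (Y w)))%:E * \int[P]_w (f (col k (Y w)))%:E)%E.
Proof.
move=> jk f0 mf.
have mcol l : measurable_fun setT (fun w => f (col l (Y w))).
  by apply: mf => i; under eq_fun do rewrite mxE; exact: mY.
have sG l (A : set R) : measurable A -> <<s G l >> ((fun w => f (col l (Y w))) @^-1` A).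
  move=> mA.
  have := @mf _ (g_sigma_algebraType (G l)) (fun w => col l (Y w)) _ measurableT A mA.
  rewrite setTI; apply => i; under eq_fun do rewrite mxE.
  apply: (measurability _ (RGenOInfty.measurableE R)).
  move=> _ [_ [x ->] <-].
  rewrite setTI.
  (* The event that coordinate [i] is at most [x] is the increasing union of orthants with bound [x]
     at [i] and [n] elsewhere. *)
  rewrite (_ : _ @^-1` _ = ~` (\bigcup_n orth l (\col_q (if q == i then x else n%:R)))).
    apply: measurableC; apply: bigcupT_measurable => n; apply: sub_sigma_algebra.
    by exists (\col_q (if q == i then x else n%:R)).
  apply/seteqP; split => w; rewrite /= in_itv /= andbT.
    by move=> xY [n _ /(_ i)]; rewrite mxE eqxx leNgt xY.
  move=> H; rewrite ltNge; apply/negP => Yx; apply: H.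
  have [n Hn] := level_cover w; exists n => // q; rewrite mxE.
  by case: eqVneq => [->//|_]; have := Hn q l; rewrite mxE.
apply: indep_expectationM => // A B mA mB.
have GL l n : G l (orth l (level n)) by exists (level n).
apply: (indep_generated (@Gmeas j) (@GI j) (GL j) (orth_cover j)
  (@Gmeas k) (@GI k) (GL k) (orth_cover k)); [|exact: sG|exact: sG].
by move=> _ _ [s _ <-] [t _ <-]; exact: indep_orth.
Qed.
End independent_columns.

(** * Almost sure convergence from summable expectations *)

Section almost_sure.
Context {R : realType} {d : measure_display} {T : measurableType d}.
Variable P : probability T R.

(** The sum of the series has a finite integral, so it is finite almost everywhere and its terms
    tend to 0 there. *)
Lemma ae_cvg0_of_summable_integral (U : nat -> T -> R) (n0 : nat) (u : nat -> R) (C : R) :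
  (forall n, measurable_fun setT (U n)) -> (forall n w, 0 <= U n w) ->
  (forall n, (n0 <= n)%N -> (\int[P]_w (U n w)%:E <= (u n)%:E)%E) ->
  (forall n, \sum_(n0 <= k < n) u k <= C) ->
  {ae P, forall w, U n w @[n --> \oo] --> (0 : R)}.
Proof.
move=> mU U0 EU uC.
(* Indices below [n0], for which no bound is assumed, are set to zero; the limit does not see
   them. *)
pose V n w : R := if (n0 <= n)%N then U n w else 0.
have mV n : measurable_fun setT (V n).
  by rewrite /V; case: (n0 <= n)%N.
have V0 n w : 0 <= V n w by rewrite /V; case: ifP.
have mVE n : measurable_fun setT (fun w => (V n w)%:E) by exact/measurable_EFinP.
have fin : (\int[P]_w (\sum_(n <oo) (V n w)%:E) < +oo)%E.
  rewrite integral_nneseries//; last by move=> n w _; rewrite lee_fin.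
  apply: (@le_lt_trans _ _ C%:E); last exact: ltry.
  apply: lime_le.
    by apply: is_cvg_nneseries => n _ _; apply: integral_ge0 => w _; rewrite lee_fin.
  apply: nearW => n; apply: (@le_trans _ _ (\sum_(n0 <= k < n) u k)%:E); last by rewrite lee_fin.
  rewrite -sumEFin (big_nat_widenl n0 0)//= !big_mkord [leRHS]big_mkcond /=.
  apply: lee_sum => k _; rewrite /V; case: ifP => n0k; first exact: EU.
  by rewrite integral0.
have mS : measurable_fun setT (fun w => \sum_(n <oo) (V n w)%:E)%E.
  by apply: ge0_emeasurable_sum => // n w _; rewrite lee_fin.
have iS : P.-integrable setT (fun w => \sum_(n <oo) (V n w)%:E)%E.
  apply/integrableP; split => //.
  under eq_integral => w _.
    rewrite gee0_abs; last by apply: nneseries_ge0 => n _ _; rewrite lee_fin.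
    over.
  exact: fin.
have := integrable_ae measurableT iS.
apply: filterS => w /(_ I) Sfin.
have : cvgn (series (fun n => V n w)).
  apply: nondecreasing_is_cvgn.
    by apply/nondecreasing_seqP => n; rewrite seriesSr lerDl.
  exists (fine (\sum_(n <oo) (V n w)%:E)%E) => _ [n _ <-].
  rewrite -lee_fin fineK// /series /= -sumEFin.
  by apply: nneseries_lim_ge => k _ _; rewrite lee_fin.
move=> /cvg_series_cvg_0 H.
apply: cvg_trans H; apply: near_eq_cvg.
near=> n; rewrite /V ifT//; near: n; exact: nbhs_infty_ge.
Unshelve. all: by end_near. Qed.

End almost_sure.

(** Telescoping: the term is [1 / (k - 1) - 1 / k], so the sum is at most [1 / (n0 - 1)]; [1 < n0]
    keeps denominators nonzero. *)
Lemma sum_inv_consecutive (R : realFieldType) (n0 n : nat) : (1 < n0)%N ->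
  \sum_(n0 <= k < n) (k%:R * k.-1%:R)^-1 <= 1 :> R.
Proof.
move=> n01.
have [nn0|n0n] := leqP n n0; first by rewrite big_geq.
rewrite (@telescope_sumr_eq _ _ _ (fun k => - k.-1%:R^-1)); last 2 first.
- exact: ltnW.
- move=> k /andP[n0k _].
  have k1 : (1 < k)%N by exact: leq_trans n0k.
  case: k k1 {n0k} => [|[|k]]// _ /=.
  rewrite -!natr1; field.
  by rewrite !natr1 !pnatr_eq0.
rewrite opprK addrC lerBlDr -[leLHS]addr0 lerD ?invr_ge0//.
case: n0 n01 {n0n} => [|[|n0]]//= _.
by rewrite invf_le1 ?ltr0n// ler1n.
Qed.

(** * Variance of the whitened trace *)

Lemma mxtrace_quadratic (R : comNzRingType) (p m : nat) (Y : 'M[R]_(p, m)) (M : 'M[R]_p) :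
  \tr (Y *m Y^T *m M) = \sum_j ((col j Y)^T *m M *m col j Y) 0 0.
Proof.
rewrite -mulmxA mxtrace_mulC /mxtrace; apply: eq_bigr => j _.
by rewrite tr_col -row_mul [LHS]mxE [RHS]mxE; apply: eq_bigr => i _; rewrite !mxE.
Qed.

Section assembly.
Context {R : realType} {d : measure_display} {T : measurableType d}.
Variable P : probability T R.

Lemma iid_gaussian_variance (p m : nat) (Y : T -> 'M[R]_(p, m)) (Psi : 'M[R]_p) :
  posdef Psi -> iid_gaussian_columns P Y Psi ->
  measurable_fun setT (fun w => \tr (Y w *m (Y w)^T *m invmx Psi)) /\
  (\int[P]_w ((\tr (Y w *m (Y w)^T *m invmx Psi) - (m * p)%:R) ^+ 2)%:E = (2 * (m * p)%:R)%:E)%E.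
Proof.
move=> Psipd [GY IY].
have [A Au APsi] := posdef_factor Psipd.
pose f (x : 'cV[R]_p) := \sum_i ((A^T *m x) i 0) ^+ 2.
have PsiE : invmx Psi = A *m A^T.
  have Psiu := posdef_unitmx Psipd.
  have H : A^T *m Psi = invmx A by rewrite -[LHS](mulmxK Au) APsi mul1mx.
  have H2 : A *m A^T *m Psi = 1%:M by rewrite -mulmxA H mulmxV.
  by rewrite -[RHS](mulmxK Psiu) H2 mul1mx.
have trE w : \tr (Y w *m (Y w)^T *m invmx Psi) = \sum_j f (col j (Y w)).
  rewrite mxtrace_quadratic PsiE; apply: eq_bigr => j _.
  have -> : (col j (Y w))^T *m (A *m A^T) *m col j (Y w) =
      (A^T *m col j (Y w))^T *m (A^T *m col j (Y w)) by rewrite trmx_mul trmxK !mulmxA.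
  by rewrite mxE; apply: eq_bigr => i _; rewrite mxE expr2.
have f0 x : 0 <= f x by apply: sumr_ge0 => i _; exact: sqr_ge0.
have mf (d' : measure_display) (S : measurableType d') (X : S -> 'cV[R]_p) :
  (forall i, measurable_fun setT (fun w => X w i 0)) -> measurable_fun setT (fun w => f (X w)).
  move=> mX; apply: measurable_sum => i; apply: measurable_funX.
  under eq_fun do rewrite mxE.
  by apply: measurable_sum => k; apply: measurable_funM.
have mY i j : measurable_fun setT (fun w => Y w i j).
  by have := (GY j).1 i; under eq_fun do rewrite mxE.
have mF j : measurable_fun setT (fun w => f (col j (Y w))).
  exact: measurable_whitened_sqnorm (GY j) A.
have EF j : (\int[P]_w (f (col j (Y w)))%:E = p%:R%:E)%E.
  by have := whitened_sqnorm_moment1 (GY j) APsi.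
have EF2 j : (\int[P]_w ((f (col j (Y w))) ^+ 2)%:E = (p%:R ^+ 2 + 2 * p%:R)%:E)%E.
  by have := whitened_sqnorm_moment2 (GY j) APsi.
split.
  by under eq_fun do rewrite trE; exact: measurable_sum.
under eq_integral do rewrite trE natrM.
(* One column has mean [p] and second moment [p^2 + 2 p], whence the excess [v = 2 p]. *)
rewrite (variance_sum (F := fun j w => f (col j (Y w))) (v := 2 * p%:R))//.
  by rewrite natrM; congr EFin; ring.
move=> j k jk; rewrite (indep_columns_expectationM mY IY jk f0 mf) !EF.
by rewrite -EFinM expr2.
Qed.

End assembly.

(** * Deterministic limits and conclusion *)

Lemma ratio_cvg0 (R : realType) (N S t : nat -> R) (c : R) : 0 < c ->
  N n @[n --> \oo] --> +oo -> S n / N n @[n --> \oo] --> (1 : R) ->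
  (forall n, c * S n <= t n) ->
  `| (N n - 2 - S n) / t n | @[n --> \oo] --> (0 : R).
Proof.
move=> c0 Noo SN tS.
pose x n := S n / N n.
have N0 : \forall n \near \oo, 0 < N n by exact: cvgry_gt.
have v0 : (N n)^-1 @[n --> \oo] --> (0 : R) by apply/gtr0_cvgV0.
have x0 : \forall n \near \oo, 0 < x n.
  by apply: (cvgr_gt 1 SN); exact: ltr01.
(* Replacing [t n] by [c * S n] and dividing through by [N n] gives this majorant, whose limit is
   [0 / c]; the comparison holds once [N n] and [x n] are positive. *)
apply: (@squeeze_cvgr _ _ _ _ (cst 0) (fun n => `|1 - 2 * (N n)^-1 - x n| / (c * x n))).
- near=> n; rewrite normr_ge0 /=.
  have Nn : 0 < N n by near: n.
  have xn : 0 < x n by near: n.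
  have Sn : 0 < S n by rewrite -(divfK (lt0r_neq0 Nn) (S n)) mulr_gt0.
  have tn : 0 < t n by rewrite (lt_le_trans _ (tS n))// mulr_gt0.
  rewrite normrM normfV (gtr0_norm tn).
  apply: (@le_trans _ _ (`|N n - 2 - S n| / (c * S n))).
    by rewrite ler_wpM2l// lef_pV2 ?posrE// mulr_gt0.
  have -> : N n - 2 - S n = N n * (1 - 2 * (N n)^-1 - x n).
    by rewrite /x; field; rewrite gt_eqF.
  rewrite normrM (gtr0_norm Nn).
  have -> : c * S n = N n * (c * x n) by rewrite /x; field; rewrite gt_eqF.
  rewrite invfM mulrACA divff ?gt_eqF// mul1r.
  exact: lexx.
- exact: cvg_cst.
- have -> : (0 : R) = `|1 - 2 * 0 - 1| / (c * 1) by rewrite mulr0 subr0 subrr normr0 mul0r.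
  apply: cvgM.
    apply: cvg_norm; apply: cvgB => //; apply: cvgB; first exact: cvg_cst.
    exact: cvgMr.
  apply: cvgV; first by rewrite mulr1 gt_eqF.
  exact: cvgMr.
Unshelve. all: by end_near. Qed.

Lemma mxtrace_ge_inv (R : realType) (p m : nat) (Y : 'M[R]_(p, m)) (M : 'M[R]_p) (tau : 'I_p -> R) (c : R) :
  posdef M -> eigenvalues_of M tau -> (forall j, c <= tau j) -> 0 < c ->
  c * \tr (Y *m Y^T *m invmx M) <= \tr (Y *m Y^T).
Proof.
move=> Mpd Mtau ctau c0.
have Mu := posdef_unitmx Mpd.
rewrite -[X in _ <= \tr X]mulmx1 !mxtrace_quadratic mulr_sumr; apply: ler_sum => j _.
rewrite mulmx1; apply: inv_quadratic_bound => //; first exact: Mpd.1.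
exact: eigenvalues_lower_bound Mpd Mtau ctau c0.
Qed.

(** Positivity of [n] makes the truncated predecessor [n.-1] agree with [n%:R - 1] in [b_S]. *)
Lemma b_S_sub_b_star (R : realType) (n p : nat) (W Psi : 'M[R]_p) (alphahat c0 : R) : (0 < n)%N ->
  b_S n W alphahat c0 / \tr W - b_star n W alphahat c0 Psi / \tr W =
  ((n.-1 * p)%:R - 2 - \tr (W *m invmx Psi)) / \tr W.
Proof.
case: n => [//|n] _; rewrite -mulrBl; congr (_ / _).
rewrite /b_S /b_star natrM -[in n.+1%:R]natr1 /=; ring.
Qed.

Lemma cvg_of_sqr_dist (R : realType) (x : nat -> R) (l : R) :
  (x n - l) ^+ 2 @[n --> \oo] --> (0 : R) -> x n @[n --> \oo] --> l.
Proof.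
move=> H; apply/cvgrPdist_lt => e e0.
have /cvgrPdist_lt/(_ (e ^+ 2)) := H; rewrite exprn_gt0// => /(_ isT).
apply: filterS => n; rewrite sub0r normrN ger0_norm ?sqr_ge0// => Hn.
by rewrite distrC ltr_norml; apply/andP; split; nra.
Qed.

Theorem theorem5 (R : realType) (d : measure_display) (T : measurableType d)
  (P : probability T R)
  (p : nat -> nat) (Psi : forall n, 'M[R]_(p n))
  (Y : forall n, T -> 'M[R]_(p n, n.-1))
  (alphahat : forall n, 'M[R]_(p n) -> R) (c0 gamma c1 c2 alpha : R)
  (H : R -> R) :
  (forall n, posdef (Psi n)) ->
  (forall n, iid_gaussian_columns P (Y n) (Psi n)) ->
  0 <= c0 ->
  (forall n M, 0 <= alphahat n M) ->
  (* (A1) *)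
  0 < gamma -> gamma != 1 ->
  (fun n => n%:R / (p n)%:R) @ \oo --> gamma ->
  (* (A2) *)
  0 < c1 -> c1 <= c2 ->
  (exists tau : forall n, 'I_(p n) -> R,
     (forall n, eigenvalues_of (Psi n) (tau n)) /\
     (forall n j, c1 <= tau n j <= c2) /\
     distribution_function H /\
     cvg_distribution (fun n => esd (tau n)) H) ->
  (* (A3) *)
  0 < alpha ->
  {ae P, forall w, (fun n => alphahat n (Y n w *m (Y n w)^T) / n%:R)
                     @ \oo --> alpha} ->
  (* conclusion *)
  {ae P, forall w,
     (fun n =>
        let W := Y n w *m (Y n w)^T in
        let ah := alphahat n W in
        `| b_S n W ah c0 / \tr W - b_star n W ah c0 (Psi n) / \tr W |)
     @ \oo --> (0 : R)}.
Proof.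
move=> Psipd iid _ _ g0 _ ng c10 _ [tau [Htau [tauc _]]] _ _.
pose S n w := \tr (Y n w *m (Y n w)^T *m invmx (Psi n)).
pose N n : R := (n.-1 * p n)%:R.
pose U n w := (S n w / N n - 1) ^+ 2.
have mS n : measurable_fun setT (S n) := (iid_gaussian_variance (Psipd n) (iid n)).1.
have VS n : (\int[P]_w ((S n w - N n) ^+ 2)%:E = (2 * N n)%:E)%E :=
  (iid_gaussian_variance (Psipd n) (iid n)).2.
have mU n : measurable_fun setT (U n).
  by apply: measurable_funX; apply: measurable_funB => //; exact: measurable_funM.
have U0 n w : 0 <= U n w by exact: sqr_ge0.
have EU n : N n != 0 -> (\int[P]_w (U n w)%:E = (2 / N n)%:E)%E.
  move=> N0; have UE w : U n w = (N n) ^- 2 * (S n w - N n) ^+ 2.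
    by rewrite /U; move: (N n) N0 (S n w) => a a0 s; field.
  under eq_integral do rewrite UE EFinM.
  rewrite ge0_integralZl//; last 3 first.
  - by apply/measurable_EFinP; apply: measurable_funX; exact: measurable_funB.
  - by move=> w _; rewrite lee_fin sqr_ge0.
  - by rewrite lee_fin invr_ge0 sqr_ge0.
  by rewrite VS -EFinM; congr EFin; move: (N n) N0 => a a0; field.
(* The upper bound makes [p n] grow at least like [n / (2 gamma)]; the lower one excludes [p n = 0],
   where the ratio is 0 by the convention on inverses. *)
have : \forall n \near \oo, 0 < (n%:R / (p n)%:R : R) < 2 * gamma.
  near=> n; apply/andP; split; near: n.
    exact: (cvgr_gt gamma ng).
  by apply: (cvgr_lt gamma ng); rewrite ltr_pMl// ltr1n.
move=> [n1 _ Hn1].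
pose n0 := maxn n1 2.
have p0 n : (n0 <= n)%N -> (0 < p n)%N.
  rewrite geq_max => /andP[/Hn1/= /andP[np0 _] _].
  by rewrite lt0n; apply/eqP => pn; move: np0; rewrite pn invr0 mulr0 ltxx.
(* [p n > n / (2 gamma)] turns [2 / (n.-1 * p n)] into a multiple of the telescoping term; [n >= 2]
   keeps [n.-1] positive. *)
have NE n : (n0 <= n)%N -> 0 < N n /\ 2 / N n <= 4 * gamma * (n%:R * n.-1%:R)^-1.
  move=> n0n; have pn := p0 n n0n.
  have n2 : (1 < n)%N by apply: leq_trans n0n; rewrite leq_max leqnn orbT.
  have n1n : (n1 <= n)%N by apply: leq_trans n0n; rewrite leq_max leqnn.
  have a0 : 0 < n.-1%:R :> R by rewrite ltr0n -ltnS prednK// ltnW.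
  have b0 : 0 < n%:R :> R by rewrite ltr0n ltnW.
  have q0 : 0 < (p n)%:R :> R by rewrite ltr0n.
  split; first by rewrite /N natrM mulr_gt0.
  have /andP[_] := Hn1 n n1n; rewrite ltr_pdivrMr// => np.
  rewrite /N natrM ler_pdivlMr ?mulr_gt0// mulrC mulrA ler_pdivrMr ?mulr_gt0//.
  have := ler_wpM2l (ltW a0) (ltW np); nra.
have ae0 : {ae P, forall w, U n w @[n --> \oo] --> (0 : R)}.
  apply: (@ae_cvg0_of_summable_integral _ _ _ P U n0
    (fun n => 4 * gamma * (n%:R * n.-1%:R)^-1) (4 * gamma)) => //.
    move=> n /NE[N0 NU]; rewrite EU ?gt_eqF//.
  move=> n; rewrite -mulr_sumr ler_piMr ?mulr_ge0 ?(ltW g0)//.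
  by apply: sum_inv_consecutive; rewrite /n0 leq_max leqnn orbT.
have Noo : N n @[n --> \oo] --> +oo.
  apply/cvgryPge => A; near=> n.
  have n0n : (n0 <= n)%N by near: n; exact: nbhs_infty_ge.
  apply: (@le_trans _ _ (Num.bound `|A|)%:R).
    exact: le_trans (ler_norm A) (ltW (archi_boundP (normr_ge0 A))).
  rewrite /N ler_nat; apply: (@leq_trans n.-1); last by rewrite leq_pmulr// p0.
  by rewrite -ltnS prednK; near: n; [exact: nbhs_infty_gt|exact: nbhs_infty_gt].
apply: filterS ae0 => w /= Uw.
have SN : S n w / N n @[n --> \oo] --> (1 : R) by exact: cvg_of_sqr_dist.
have tS n : c1 * S n w <= \tr (Y n w *m (Y n w)^T).
  apply: (mxtrace_ge_inv _ (Psipd n) (Htau n)) => // j.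
  by have /andP[] := tauc n j.
have := ratio_cvg0 c10 Noo SN tS; apply: cvg_trans; apply: near_eq_cvg.
near=> n; rewrite b_S_sub_b_star//; near: n; exact: nbhs_infty_gt.
Unshelve. all: by end_near. Qed.
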